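(* For any compilation chain and any trace relation ${\sim}\subseteq\mathit{Trace}_S\times\mathit{Trace}_T$ with existential and universal images $\tilde\tau,\tilde\sigma$ (lifted to hyperproperties), $\mathit{HC}^{\sim}$ is equivalent to $\mathit{HP}^{\tilde\tau}$. Moreover, if $\tilde\tau\circ\tilde\sigma=\mathrm{id}$ (a Galois insertion), then $\mathit{HC}^{\sim}$ implies $\mathit{HP}^{\tilde\sigma}$; and if $\tilde\sigma\circ\tilde\tau=\mathrm{id}$ (a Galois reflection), then $\mathit{HP}^{\tilde\sigma}$ implies $\mathit{HC}^{\sim}$. Here $\mathit{HC}^{\sim}\equiv\forall W.\ \mathit{beh}(W{\downarrow})=\tilde\tau(\mathit{beh}(W))$; $\mathit{HP}^{\tilde\tau}\equiv\forall W\ \forall H_S.\ W\models H_S\Rightarrow W{\downarrow}\models\tilde\tau(H_S)$; $\mathit{HP}^{\tilde\sigma}\equiv\forall W\ \forall H_T.\ W\models\tilde\sigma(H_T)\Rightarrow W{\downarrow}\models H_T$.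
   Context: A compilation chain consists of source (whole) programs $W$, target programs, sets $\mathit{Trace}_S,\mathit{Trace}_T$ of traces, semantics relations $W\rightsquigarrow t$ at both levels, and a compiler $W\mapsto W{\downarrow}$. $\mathit{beh}(W)=\{t\mid W\rightsquigarrow t\}$. A hyperproperty is a set of sets of traces; $W\models H$ iff $\mathit{beh}(W)\in H$. The existential image of $\sim$ is $\tilde\tau(\pi)=\{t\mid\exists s.\ s\sim t\wedge s\in\pi\}$ and its universal image is $\tilde\sigma(\pi)=\{s\mid\forall t.\ s\sim t\Rightarrow t\in\pi\}$; on hyperproperties, $\tilde\tau(H_S)=\{\tilde\tau(\pi)\mid\pi\in H_S\}$ and $\tilde\sigma(H_T)=\{\tilde\sigma(\pi)\mid\pi\in H_T\}$. The identities $\tilde\tau\circ\tilde\sigma=\mathrm{id}$, $\tilde\sigma\circ\tilde\tau=\mathrm{id}$ refer to the maps on trace properties. *)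

(* Defs.v *)
(* Sets of traces are predicates [T -> Prop]; equality of sets
   is Leibniz equality of predicates (extensional under the whitelisted
   functional/propositional extensionality axioms). *)
From Stdlib Require Import FunctionalExtensionality PropExtensionality.

Definition prop (T : Type) := T -> Prop.
Definition hprop (T : Type) := prop T -> Prop.

Definition beh {P T : Type} (sem : P -> T -> Prop) (W : P) : prop T :=
  fun t => sem W t.

Definition hsat {P T : Type} (sem : P -> T -> Prop) (W : P) (H : hprop T) : Prop :=
  H (beh sem W).

Definition tau_tilde {TS TT : Type} (rel : TS -> TT -> Prop) (pi : prop TS) : prop TT :=
  fun t => exists s, rel s t /\ pi s.

Definition sigma_tilde {TS TT : Type} (rel : TS -> TT -> Prop) (pi : prop TT) : prop TS :=
  fun s => forall t, rel s t -> pi t.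

Definition hlift {A B : Type} (f : prop A -> prop B) (H : hprop A) : hprop B :=
  fun p => exists pi, H pi /\ p = f pi.

Section Criteria.
Context {PS PT TS TT : Type}
  (semS : PS -> TS -> Prop) (semT : PT -> TT -> Prop)
  (comp : PS -> PT) (rel : TS -> TT -> Prop).

Definition HC : Prop :=
  forall W : PS, beh semT (comp W) = tau_tilde rel (beh semS W).

Definition HP_tau : Prop :=
  forall (W : PS) (HS : hprop TS),
    hsat semS W HS -> hsat semT (comp W) (hlift (tau_tilde rel) HS).

Definition HP_sigma : Prop :=
  forall (W : PS) (HT : hprop TT),
    hsat semS W (hlift (sigma_tilde rel) HT) -> hsat semT (comp W) HT.
End Criteria.

(* Main.v *)
(** Hyperproperty preservation applied to the strongest hyperproperty a
    program satisfies, the singleton [{beh W}], already pins down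
    [beh (W↓)]; this gives the converse of the easy implication
    [HC -> HP_tau].  For the Galois cases, [tau ∘ sigma = id] rewrites
    [beh (W↓) = tau (sigma pi)] to [pi], and [sigma ∘ tau = id] shows that
    [W] satisfies [sigma {tau (beh W)}], so [HP_sigma] yields [HC]. *)
Require Import Defs.

Definition hsingle {T : Type} (pi : prop T) : hprop T := fun p => p = pi.

Lemma hlift_mem {A B : Type} (f : prop A -> prop B) (H : hprop A) (pi : prop A) :
  H pi -> hlift f H (f pi).
Proof. intros Hpi. exists pi. split; [exact Hpi | reflexivity]. Qed.

Lemma hlift_hsingle_inv {A B : Type} (f : prop A -> prop B) (pi : prop A) (p : prop B) :
  hlift f (hsingle pi) p -> p = f pi.
Proof. intros [pi' [-> ->]]. reflexivity. Qed.

Section Criteria.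
Context {PS PT TS TT : Type}
  (semS : PS -> TS -> Prop) (semT : PT -> TT -> Prop)
  (comp : PS -> PT) (rel : TS -> TT -> Prop).

Lemma HC_HP_tau : HC semS semT comp rel -> HP_tau semS semT comp rel.
Proof.
  intros Hc W HS HW. unfold hsat. rewrite (Hc W). exact (hlift_mem _ HS _ HW).
Qed.

Lemma HP_tau_HC : HP_tau semS semT comp rel -> HC semS semT comp rel.
Proof.
  intros Hp W. apply (hlift_hsingle_inv (tau_tilde rel) (beh semS W)), Hp.
  reflexivity.
Qed.

Lemma HC_HP_sigma_insertion :
  (forall pi : prop TT, tau_tilde rel (sigma_tilde rel pi) = pi) ->
  HC semS semT comp rel -> HP_sigma semS semT comp rel.
Proof.
  intros Hins Hc W HT [pi [Hpi Hbeh]]. unfold hsat.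
  rewrite (Hc W), Hbeh, Hins. exact Hpi.
Qed.

Lemma HP_sigma_HC_reflection :
  (forall pi : prop TS, sigma_tilde rel (tau_tilde rel pi) = pi) ->
  HP_sigma semS semT comp rel -> HC semS semT comp rel.
Proof.
  intros Hrefl Hp W. set (pi := tau_tilde rel (beh semS W)).
  apply Hp with (HT := hsingle pi).
  assert (Hsat : hlift (sigma_tilde rel) (hsingle pi) (sigma_tilde rel pi))
    by (apply hlift_mem; reflexivity).
  unfold pi in Hsat at 2. rewrite Hrefl in Hsat. exact Hsat.
Qed.

End Criteria.

Theorem theoremB3 (PS PT TS TT : Type)
  (semS : PS -> TS -> Prop) (semT : PT -> TT -> Prop)
  (comp : PS -> PT) (rel : TS -> TT -> Prop) :
  (HC semS semT comp rel <-> HP_tau semS semT comp rel)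
  /\ ((forall pi : prop TT, tau_tilde rel (sigma_tilde rel pi) = pi) ->
      HC semS semT comp rel -> HP_sigma semS semT comp rel)
  /\ ((forall pi : prop TS, sigma_tilde rel (tau_tilde rel pi) = pi) ->
      HP_sigma semS semT comp rel -> HC semS semT comp rel).
Proof.
  split; [split | split].
  - apply HC_HP_tau.
  - apply HP_tau_HC.
  - apply HC_HP_sigma_insertion.
  - apply HP_sigma_HC_reflection.
Qed.
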